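(* Every convex drawing of the complete graph $K_7$ contains a $5$-face.
   Context: A rectilinear drawing $D$ of $K_n$ represents the vertices of $K_n$ by $n$ distinct points in the plane $\mathbb{R}^2$, no three of which lie on a common line, and represents each edge by the line segment connecting the points representing its end-vertices. The drawing $D$ is convex if the points representing the vertices are in convex position (three or more edges are allowed to share a common interior point). Identify $D$ with the union of its points and segments. A face of $D$ is a non-empty connected component of $\mathbb{R}^2 \setminus D$. Exactly one face is unbounded, and every bounded face is (the interior of) a convex polygon; the size of a bounded face is the number of vertices (corners) of this polygon. A bounded face of size $k$ is called a $k$-face of $D$. *)

(* Defs.v *)
From mathcomp Require Export all_boot all_order all_algebra.
From mathcomp Require Export all_classical all_reals all_analysis.
Export Order.TTheory GRing.Theory Num.Theory.
Export numFieldNormedType.Exports.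

Set Implicit Arguments.
Unset Strict Implicit.
Unset Printing Implicit Defensive.

Local Open Scope classical_set_scope.
Local Open Scope ring_scope.

Definition segment (R : realType) (a b : 'rV[R]_2) : set 'rV[R]_2 :=
  [set (1 - t) *: a + t *: b | t in `[0, 1]].

(* The line through [a] and [b] when [a != b]. *)
Definition line (R : realType) (a b : 'rV[R]_2) : set 'rV[R]_2 :=
  [set (1 - t) *: a + t *: b | t in [set: R]].

Definition convex_hull (R : realType) (A : set 'rV[R]_2) : set 'rV[R]_2 :=
  smallest (@convex_set R 'rV[R]_2) A.

Definition no_three_collinear (R : realType) (n : nat)
    (p : 'I_n -> 'rV[R]_2) : Prop :=
  forall i j k : 'I_n, i != j -> i != k -> j != k -> ~ line (p i) (p j) (p k).

Definition in_convex_position (R : realType) (n : nat)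
    (p : 'I_n -> 'rV[R]_2) : Prop :=
  forall i : 'I_n, ~ convex_hull [set p j | j in [set j | j != i]] (p i).

(* A rectilinear drawing of K_n is determined by the positions of the vertices,
   the edge {i, j} being drawn as the segment from [p i] to [p j]. *)
Definition rectilinear_drawing (R : realType) (n : nat)
    (p : 'I_n -> 'rV[R]_2) : Prop :=
  injective p /\ no_three_collinear p.

Definition convex_drawing (R : realType) (n : nat)
    (p : 'I_n -> 'rV[R]_2) : Prop :=
  rectilinear_drawing p /\ in_convex_position p.

Definition drawing_set (R : realType) (n : nat)
    (p : 'I_n -> 'rV[R]_2) : set 'rV[R]_2 :=
  range p `|`
  \bigcup_(e in [set e : 'I_n * 'I_n | e.1 != e.2]) segment (p e.1) (p e.2).

Definition is_face (R : realType) (n : nat) (p : 'I_n -> 'rV[R]_2)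
    (F : set 'rV[R]_2) : Prop :=
  exists2 x, (~` drawing_set p) x &
    F = connected_component (~` drawing_set p) x.

(* [F] is the interior of a convex polygon with exactly [k] corners: convex
   position of [v] makes every [v i] a corner of the hull, so [k] is determined
   by [F] when [F] is non-empty. *)
Definition polygon_interior (R : realType) (k : nat)
    (F : set 'rV[R]_2) : Prop :=
  exists2 v : 'I_k -> 'rV[R]_2,
    in_convex_position v & F = interior (convex_hull (range v)).

Definition is_kface (R : realType) (n : nat) (p : 'I_n -> 'rV[R]_2)
    (k : nat) (F : set 'rV[R]_2) : Prop :=
  [/\ is_face p F, bounded_set F & polygon_interior k F].

(* Main.v *)
Require Import Defs.
From mathcomp Require Import ring lra zify.

(** Label the seven points [0, ..., 6] counterclockwise.  For a vertex [v], the
    diagonals from [v] to the two vertices opposite to it bound a wedge with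
    apex [v].  The diagonals [{v+1, v-2}] and [{v-1, v+2}] both run across this
    wedge; let [z] be the point where they cross.  If [z] lies strictly inside
    the wedge, then the part of the wedge between the short diagonal
    [{v-1, v+1}] and these two diagonals is a pentagon, with [z] as one of its
    corners, and no edge of the drawing enters it: each of the 21 edges has both
    of its ends on the line, or on the outer side, of one and the same chord
    among the five that carry the sides ([chord_cell_kface], [apex_pentagon]).

    It remains to find a vertex whose [z] is inside its wedge.  The point [z]
    cannot be outside both boundary lines of the wedge at once, because it lies
    inside the heptagon ([inside_one_boundary]).  Moreover the condition
    that [z] be inside one boundary line says that three long diagonals form a
    triangle of a given orientation, and each of these triples of diagonals is
    shared by two neighbouring vertices: it governs the boundary [{v, v+3}] of
    [v] and the boundary [{v+1, v+5}] of [v+1] ([inside04_shift]).  So there are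
    seven cyclically ordered signs, no two neighbours of which are both
    non-positive.  As seven is odd, the signs cannot alternate, hence two
    neighbours are both positive, and the vertex between them has its [z] inside
    the wedge.  Degenerate positions, where three diagonals are concurrent, are
    covered as vanishing signs.

    The topological half identifies a face from its corners.  The points to the
    left of all sides of a counterclockwise polygon form an open convex set whose
    closure adds only points of the sides.  If the sides are drawn and nothing is
    drawn inside, this set is therefore relatively clopen in every connected set
    that meets it and avoids the drawing, so it is a face ([polygon_kface]).  It
    is the interior of the hull of the corners by a fan decomposition from one
    corner ([polygon_cell_hull], [polygon_cell_interior]).

    All positions are expressed through the signs of [orient], which makes the
    geometric steps affine or polynomial identities. *)

Set Implicit Arguments.
Unset Strict Implicit.
Unset Printing Implicit Defensive.

Local Open Scope classical_set_scope.
Local Open Scope ring_scope.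

(** * Orientation of point triples, segments and hulls *)

Section Plane.
Variable R : realType.
Implicit Types (a b c d e f x y z : 'rV[R]_2) (A : set 'rV[R]_2) (t : R).

(** Twice the signed area of the triangle: positive when [c] lies to the left of
    the line directed from [a] to [b]. *)
Definition orient a b c : R :=
  (b 0 0 - a 0 0) * (c 0 1 - a 0 1) - (b 0 1 - a 0 1) * (c 0 0 - a 0 0).

Lemma orient_rot a b c : orient a b c = orient b c a.
Proof. by rewrite /orient; ring. Qed.

Lemma orient_swap a b c : orient b a c = - orient a b c.
Proof. by rewrite /orient; ring. Qed.

Lemma orient_swapr a b c : orient a c b = - orient a b c.
Proof. by rewrite /orient; ring. Qed.

Lemma orient_start a b : orient a b a = 0.
Proof. by rewrite /orient; ring. Qed.

Lemma orient_end a b : orient a b b = 0.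
Proof. by rewrite /orient; ring. Qed.

Lemma orient_conv a b x y t :
  orient a b ((1 - t) *: x + t *: y) = (1 - t) * orient a b x + t * orient a b y.
Proof. by rewrite /orient !mxE; ring. Qed.

Lemma orient_subsegment a b s t x :
  orient ((1 - s) *: a + s *: b) ((1 - t) *: a + t *: b) x =
  (t - s) * orient a b x.
Proof. by rewrite /orient !mxE; ring. Qed.

Lemma conv_gt0 (u w s : R) :
  0 < u -> 0 < w -> 0 <= s -> s <= 1 -> 0 < (1 - s) * u + s * w.
Proof.
move=> u0 w0; rewrite le_eqVlt => /predU1P[<- _|s0 s1].
  by rewrite subr0 mul1r mul0r addr0.
by rewrite ltr_wpDl ?mulr_gt0 // mulr_ge0 ?subr_ge0 // ltW.
Qed.

Lemma orient_segment_le0 a b x y z : segment x y z ->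
  orient a b x <= 0 -> orient a b y <= 0 -> orient a b z <= 0.
Proof.
move=> [s /=]; rewrite in_itv /= => /andP[s0 s1] <- ax ay.
by rewrite orient_conv; nra.
Qed.

Lemma point_eq x y : x 0 0 = y 0 0 -> x 0 1 = y 0 1 -> x = y.
Proof.
move=> x0 x1; apply/rowP=> -[[|[|//]] lti].
  by rewrite (_ : Ordinal lti = 0) //; apply/val_inj.
by rewrite (_ : Ordinal lti = 1) //; apply/val_inj.
Qed.

(** On the line [ab] the affine function [orient c a] vanishes at [a] and not at
    [b], so its values are the coordinate along the line. *)
Lemma orient_line c a b x : orient c a b != 0 -> orient a b x = 0 ->
  x = (1 - orient c a x / orient c a b) *: a + (orient c a x / orient c a b) *: b.
Proof.
move=> cab0 abx; apply: point_eq; rewrite !mxE; apply: (mulfI cab0).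
  transitivity (orient c a b * a 0 0 + orient c a x * (b 0 0 - a 0 0)
                - orient a b x * (a 0 0 - c 0 0)).
    by rewrite /orient; ring.
  by rewrite abx; field.
transitivity (orient c a b * a 0 1 + orient c a x * (b 0 1 - a 0 1)
              - orient a b x * (a 0 1 - c 0 1)).
  by rewrite /orient; ring.
by rewrite abx; field.
Qed.

Lemma orient0_line a b x : a != b -> orient a b x = 0 -> line a b x.
Proof.
move=> ab abx.
(* The vector from a to c is b - a turned by a right angle, so c is off the line. *)
pose c : 'rV[R]_2 := \row_j (if j == 0 then a 0 0 - (b 0 1 - a 0 1)
                             else a 0 1 + (b 0 0 - a 0 0)).
have cab : orient c a b = (b 0 0 - a 0 0) ^+ 2 + (b 0 1 - a 0 1) ^+ 2.
  by rewrite /orient !mxE /=; ring.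
have cab0 : orient c a b != 0.
  rewrite cab paddr_eq0 ?sqr_ge0 // !sqrf_eq0 !subr_eq0.
  apply/negP => /andP[/eqP b0 /eqP b1]; case/eqP: ab.
  exact/esym/point_eq.
by have := orient_line cab0 abx; set t := _ / _ => xE; exists t.
Qed.

Lemma segment_start a b : segment a b a.
Proof.
exists 0; first by rewrite /= in_itv /= lexx ler01.
by rewrite subr0 scale1r scale0r addr0.
Qed.

Lemma segment_end a b : segment a b b.
Proof.
exists 1; first by rewrite /= in_itv /= lexx ler01.
by rewrite subrr scale1r scale0r add0r.
Qed.

Lemma subsegment a b x y : segment a b x -> segment a b y ->
  segment x y `<=` segment a b.
Proof.
move=> [s /= s01 <-] [t /= t01 <-] z [r /= r01 <-].
exists ((1 - r) * s + r * t); last by apply: point_eq; rewrite !mxE; ring.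
move: s01 t01 r01; rewrite /= !in_itv /=.
by move=> /andP[s0 s1] /andP[t0 t1] /andP[r0 r1]; apply/andP; split; nra.
Qed.

Lemma convex_segmentP A :
  convex_set A <-> forall x y, A x -> A y -> segment x y `<=` A.
Proof.
split=> [cA x y Ax Ay z [s /=]|cA x y l].
  rewrite in_itv /= => /andP[s0 s1] <-.
  have t0 : 0 <= 1 - s by lra.
  have t1 : 1 - s <= 1 by lra.
  have := cA x y (Itv01 t0 t1).
  rewrite !inE => /(_ Ax Ay); rewrite /conv /=.
  by rewrite /unstable.onem subKr.
rewrite !inE => Ax Ay; apply: (cA x y Ax Ay); exists (1 - l%:num).
  by rewrite /= in_itv /= subr_ge0 lerBlDr lerDl; apply/andP.
by rewrite subKr.
Qed.

Lemma hull_convex A x y : convex_hull A x -> convex_hull A y ->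
  segment x y `<=` convex_hull A.
Proof.
move=> Ax Ay z xyz C [cC AC].
exact: (convex_segmentP C).1 cC _ _ (Ax C (conj cC AC)) (Ay C (conj cC AC)) _ xyz.
Qed.

(** The three orientations are proportional to the barycentric coordinates of
    [x]. *)
Lemma triangle_hull A a b c x : A a -> A b -> A c ->
  0 < orient a b x -> 0 < orient b c x -> 0 <= orient c a x -> convex_hull A x.
Proof.
move=> Aa Ab Ac; set u := orient a b x; set v := orient b c x.
set w := orient c a x => u0 v0 w0.
have hA z : A z -> convex_hull A z by exact: sub_gen_smallest.
have vw0 : v + w != 0 by apply: lt0r_neq0; lra.
have uvw0 : u + v + w != 0 by apply: lt0r_neq0; lra.
(* y is the point where the line from c through x leaves the triangle. *)
pose y := (1 - w / (v + w)) *: a + (w / (v + w)) *: b.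
have hy : convex_hull A y.
  apply: (hull_convex (hA a Aa) (hA b Ab)); exists (w / (v + w)) => //=.
  by rewrite in_itv /= ler_pdivrMr ?divr_ge0; try apply/andP; try split; lra.
apply: (hull_convex hy (hA c Ac)); exists (u / (u + v + w)) => /=.
  by rewrite in_itv /= ler_pdivrMr ?divr_ge0; try apply/andP; try split; lra.
by apply: point_eq; rewrite !mxE; apply: (mulfI uvw0);
  rewrite /u /v /w /orient in vw0 uvw0 *; field; rewrite vw0 uvw0.
Qed.

Lemma hull_bounded n (v : 'I_n -> 'rV[R]_2) : bounded_set (convex_hull (range v)).
Proof.
pose M := \sum_i `|v i|.
have vM i : `|v i| <= M by rewrite /M (bigD1 i) //= lerDl sumr_ge0.
have sub : convex_hull (range v) `<=` [set x | `|x| <= M].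
  apply: smallest_sub => [|_ [i _ <-]]; last exact: vM.
  apply/convex_segmentP => x y /= xM yM z [s /=].
  rewrite in_itv /= => /andP[s0 s1] <-.
  apply: (le_trans (ler_normD _ _)); rewrite !normrZ !ger0_norm ?subr_ge0 //.
  rewrite [leRHS](_ : M = (1 - s) * M + s * M); last by ring.
  by apply: lerD; apply: ler_wpM2l; rewrite ?subr_ge0.
exists M; split; first exact: num_real.
by move=> N MN x /sub /= xM; apply: (le_trans xM); exact: ltW.
Qed.

Lemma orient_continuous a b : continuous (orient a b).
Proof.
have cB j : continuous (fun c : 'rV[R]_2 => c 0 j - a 0 j).
  move=> x; exact: (@continuousB _ R^o _ _ _ x
    (@coord_continuous _ _ _ _ _ x) (@cst_continuous _ R^o (a 0 j) x)).
have cM u j : continuous (fun c : 'rV[R]_2 => u * (c 0 j - a 0 j)).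
  move=> x; exact: (continuousM (@cst_continuous _ R^o u x) (cB j x)).
move=> x; exact: (@continuousB _ R^o _ _ _ x (cM _ 1 x) (cM _ 0 x)).
Qed.

Lemma segment_continuous a b : continuous (fun t => (1 - t) *: a + t *: b).
Proof.
move=> t; apply: cvgD; apply: cvgZr_tmp => //.
by apply: cvgB => //; exact: cvg_cst.
Qed.

Lemma connected_segment a b : connected (segment a b).
Proof.
apply: (connected_continuous_connected (@segment_connected R 0 1)).
apply: continuous_subspaceT; exact: segment_continuous.
Qed.

End Plane.

(** * Counterclockwise polygons and faces *)

Section Polygon.
Variables (R : realType) (m : nat).
Local Notation n := m.+3.
Variable v : 'I_n -> 'rV[R]_2.

Definition ccw_polygon :=
  forall i k : 'I_n, k != i -> k != ordS i -> 0 < orient (v i) (v (ordS i)) (v k).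

Definition polygon_cell : set 'rV[R]_2 :=
  [set x | forall i, 0 < orient (v i) (v (ordS i)) x].

Lemma ordS_neq (i : 'I_n) : ordS i != i.
Proof.
rewrite -val_eqE; case: i => i /=; rewrite leq_eqVlt => /orP[/eqP[->]|lt].
  by rewrite modnn.
by rewrite modn_small //; lia.
Qed.

Lemma ordSS_neq (i : 'I_n) : ordS (ordS i) != i.
Proof.
rewrite -val_eqE; case: i => i /=; rewrite -[X in (X %% _)%N]addn1 modnDml addn1.
rewrite leq_eqVlt => /orP[/eqP[->]|].
  by rewrite -add1n modnDr modn_small.
rewrite ltnS leq_eqVlt => /orP[/eqP[->]|lt]; first by rewrite modnn.
by rewrite modn_small //; lia.
Qed.

Hypothesis v_ccw : ccw_polygon.

Lemma polygon_hull_ge0 x i : convex_hull (range v) x ->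
  0 <= orient (v i) (v (ordS i)) x.
Proof.
move: x; apply: (@smallest_sub _ _ _ [set x | 0 <= orient (v i) (v (ordS i)) x]).
  apply/convex_segmentP => x y /= x0 y0 z [s /=].
  rewrite in_itv /= => /andP[s0 s1] <-.
  by rewrite orient_conv addr_ge0 // mulr_ge0 // subr_ge0.
move=> _ [k _ <-] /=; have [->|ki] := eqVneq k i; first by rewrite orient_start.
have [->|kSi] := eqVneq k (ordS i); first by rewrite orient_end.
exact/ltW/v_ccw.
Qed.

Lemma polygon_side_ge0 i k : 0 <= orient (v i) (v (ordS i)) (v k).
Proof. by apply: polygon_hull_ge0; apply: sub_gen_smallest; exists k. Qed.

(** Fan decomposition from corner [0]: seen from there, [x] is to the left of
    corner [1] and to the right of the last corner, so two consecutive corners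
    [k + 1] and [k + 2] have [x] between them, and [x] is in the triangle that
    they form with corner [0]. *)
Lemma polygon_cell_hull : polygon_cell `<=` convex_hull (range v).
Proof.
move=> x xP; pose w j := v (inZp j).
have wS j : v (ordS (inZp j)) = w j.+1.
  congr v; apply: val_inj => /=.
  by rewrite -[X in (X %% _)%N]addn1 modnDml addn1.
have side j : 0 < orient (w j) (w j.+1) x by rewrite -wS; exact: xP.
have leave : exists j, (0 < j)%N && (orient (w 0%N) (w j) x <= 0).
  exists m.+2; rewrite /= -oppr_ge0 -orient_swap.
  apply: ltW; rewrite [w 0%N](_ : _ = w n) //; congr v.
  by apply: val_inj; rewrite /= modnn.
case: (ex_minnP leave) => -[//|[|k]] /andP[_ wk] kmin.
  by have := side 0%N; rewrite ltNge wk.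
have wv j : range v (w j) by exists (inZp j).
apply: (@triangle_hull _ _ (w 0%N) (w k.+1) (w k.+2)) => //.
  rewrite ltNge; apply/negP => wk1.
  by have := kmin k.+1; rewrite wk1 => /(_ isT); rewrite ltnn.
by rewrite orient_swap oppr_ge0.
Qed.

Lemma polygon_cell_open : open polygon_cell.
Proof.
rewrite openE => x xP.
apply: (@filter_forall _ _ (fun i y => 0 < orient (v i) (v (ordS i)) y)
  _ (nbhs_filter x)) => i.
exact: (@orient_continuous _ _ _ x [set t | 0 < t] (lt_nbhsr (xP i))).
Qed.

Lemma polygon_cell_interior : polygon_cell = interior (convex_hull (range v)).
Proof.
apply/seteqP; split=> [|x hx i].
  by rewrite -open_subsetE; [exact: polygon_cell_hull|exact: polygon_cell_open].
(* Moving from an interior point x of the hull slightly away from a corner w off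
   side i stays in the hull, so x cannot lie on the line of side i. *)
set w := v (ordS (ordS i)).
have w0 : 0 < orient (v i) (v (ordS i)) w.
  by apply: v_ccw; rewrite ?ordSS_neq ?ordS_neq.
have := @segment_continuous _ w x 1 (convex_hull (range v)).
rewrite /= subrr scale0r add0r scale1r => /(_ hx) /nbhs_ballP[e /= e0].
move=> /(_ (1 + e / 2)); rewrite /ball_ /= => /(_ _)/(polygon_hull_ge0 i).
rewrite orient_conv => /(_ _) y0.
have : 0 <= (1 - (1 + e / 2)) * orient (v i) (v (ordS i)) w
            + (1 + e / 2) * orient (v i) (v (ordS i)) x.
  apply: y0; rewrite -ball_normE /ball_ /=.
  by rewrite opprD addrA subrr add0r normrN gtr0_norm; lra.
by nra.
Qed.

(** The previous and the next side bound the position of [x] along the line of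
    side [i] from below and from above. *)
Lemma polygon_boundary x i : (forall j, 0 <= orient (v j) (v (ordS j)) x) ->
  orient (v i) (v (ordS i)) x = 0 -> segment (v i) (v (ordS i)) x.
Proof.
move=> x0 xi; set j := ord_pred i; have ji : ordS j = i by exact: ord_predK.
have jpos : 0 < orient (v j) (v i) (v (ordS i)).
  by rewrite -ji; apply: v_ccw; rewrite ?ordSS_neq ?ordS_neq.
have kpos : 0 < orient (v (ordS i)) (v (ordS (ordS i))) (v i).
  by apply: v_ccw; rewrite eq_sym ?ordSS_neq ?ordS_neq.
have := orient_line (lt0r_neq0 jpos) xi; set t := _ / _ => xE.
exists t => //=; rewrite in_itv /=; apply/andP; split.
  by rewrite divr_ge0 ?(ltW jpos) // -[X in orient _ (v X)]ji.
have := x0 (ordS i); rewrite xE orient_conv orient_start mulr0 addr0.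
by rewrite pmulr_lge0 // subr_ge0.
Qed.

Lemma polygon_cell_nonempty : polygon_cell !=set0.
Proof.
(* A point inside the triangle of three distinct corners: each side has at most
   two of them on its line. *)
pose u : 'rV[R]_2 := (1 - 2^-1) *: v ord0 + 2^-1 *: v (inZp 1).
exists ((1 - 2^-1) *: u + 2^-1 *: v (inZp 2)) => i; rewrite !orient_conv.
have := polygon_side_ge0 i ord0; have := polygon_side_ge0 i (inZp 1).
have := polygon_side_ge0 i (inZp 2).
have [k] : exists2 k : 'I_n,
    k \in [:: ord0; inZp 1; inZp 2] & (k != i) && (k != ordS i).
  apply/hasP; apply: contraT => /=.
  have i01 : ord0 != inZp 1 :> 'I_n by [].
  have i02 : ord0 != inZp 2 :> 'I_n by [].
  have i12 : inZp 1 != inZp 2 :> 'I_n by [].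
  rewrite !negb_or !negb_and !negbK => /and4P[e0 e1 e2 _]; move: i01 i02 i12.
  by case/orP: e0 => /eqP->; case/orP: e1 => /eqP->; case/orP: e2 => /eqP->;
    rewrite eqxx.
rewrite !inE => k012 /andP[ki kSi]; have := v_ccw ki kSi.
by case/or3P: k012 => /eqP->; lra.
Qed.

(** The sum of the orientations with respect to the two sides at a corner
    vanishes at that corner and is positive at all the others. *)
Lemma polygon_in_convex_position : in_convex_position v.
Proof.
move=> i; rewrite -(ord_predK i); move: (ord_pred i) => j.
set f := fun x => orient (v j) (v (ordS j)) x
                  + orient (v (ordS j)) (v (ordS (ordS j))) x.
have sub : convex_hull [set v k | k in [set k | k != ordS j]]
           `<=` [set x | 0 < f x].
  apply: smallest_sub => [|_ [k /= kj <-]].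
    apply/convex_segmentP => x y /= x0 y0 z [s /=].
    rewrite in_itv /= => /andP[s0 s1] <-; rewrite /f !orient_conv.
    by rewrite addrACA -!mulrDr; exact: conv_gt0.
  have [->|kj'] := eqVneq k j; last first.
    by rewrite ltr_wpDr ?polygon_side_ge0 ?v_ccw.
  by rewrite /f orient_start add0r v_ccw // eq_sym ?ordS_neq ?ordSS_neq.
by move=> /sub /=; rewrite /f orient_end orient_start addr0 ltxx.
Qed.

Lemma polygon_kface N (p : 'I_N -> 'rV[R]_2) :
  (forall i, segment (v i) (v (ordS i)) `<=` drawing_set p) ->
  polygon_cell `&` drawing_set p = set0 ->
  is_kface p n polygon_cell.
Proof.
move=> sideD cellD; split; last first.
- by exists v; [exact: polygon_in_convex_position|exact: polygon_cell_interior].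
- have [M [Mr hM]] := hull_bounded v.
  by exists M; split=> // B MB x /polygon_cell_hull; exact: hM.
have [x xP] := polygon_cell_nonempty.
have PD y : polygon_cell y -> (~` drawing_set p) y.
  by move=> yP yD; suff: set0 y by []; rewrite -cellD; split.
exists x; first exact: PD.
apply/seteqP; split=> [y yP|y [C [Cx CD Cconn] Cy]].
  exists (segment x y); last exact: segment_end.
  split; [exact: segment_start| |exact: connected_segment].
  move=> z zxy; apply: PD => i; case: zxy => s /=.
  rewrite in_itv /= => /andP[s0 s1] <-; rewrite orient_conv.
  exact: conv_gt0 (xP i) (yP i) s0 s1.
(* Inside C the open cell and the closed polygon coincide, since the boundary of
   the polygon is drawn; so the cell is clopen in the connected set C. *)
suff CP : C `&` polygon_cell = C by move: Cy; rewrite -CP => -[].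
apply: Cconn; [by exists x|by exists polygon_cell => //; exact: polygon_cell_open|].
exists [set z | forall i, 0 <= orient (v i) (v (ordS i)) z].
  rewrite (_ : mkset _ =
      \bigcap_i (orient (v i) (v (ordS i)) @^-1` [set t | 0 <= t])); last first.
    by apply/seteqP; split=> [z zP i _|z zP i]; exact: zP.
  apply: closed_bigI => i _; apply: preimage_closed; last exact: closed_ge.
  by move=> z _; exact: orient_continuous.
apply/seteqP; split=> [z [Cz zP]|z [Cz zP]]; split=> // i; first exact/ltW/zP.
rewrite lt_neqAle zP andbT eq_sym; apply/eqP => z0.
exact: (CD z Cz) (sideD i z (polygon_boundary zP z0)).
Qed.

End Polygon.

(** * Crossing points and concurrency of chords *)

Section Crossing.
Variable R : realType.
Implicit Types a b c d e f x y : 'rV[R]_2.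

(** The intersection of the lines [ab] and [cd]. *)
Definition crossing a b c d :=
  let r := orient c d a / (orient c d a - orient c d b) in
  (1 - r) *: a + r *: b.

(** The determinant of the three lines [ab], [cd] and [ef].  Unlike the position
    of a crossing point relative to the third line, it is visibly symmetric in
    the three lines up to sign. *)
Definition concurrency a b c d e f :=
  orient c d a * orient e f b - orient c d b * orient e f a.

Lemma concurrency_rot a b c d e f :
  concurrency a b c d e f = concurrency c d e f a b.
Proof. by rewrite /concurrency /orient; ring. Qed.

Lemma concurrency_swap a b c d e f :
  concurrency b a c d e f = - concurrency a b c d e f.
Proof. by rewrite /concurrency; ring. Qed.

Lemma crossing_inside a b c d : 0 < orient c d a -> orient c d b < 0 ->
  exists r, [/\ 0 < r, r < 1 & crossing a b c d = (1 - r) *: a + r *: b].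
Proof.
move=> ha hb; exists (orient c d a / (orient c d a - orient c d b)); split=> //.
  by rewrite divr_gt0 //; lra.
by rewrite ltr_pdivrMr; lra.
Qed.

Lemma crossingC a b c d : orient c d a != orient c d b ->
  crossing a b c d = crossing d c a b.
Proof.
rewrite -subr_eq0 => cd0.
have ab0 : orient a b d - orient a b c != 0.
  rewrite (_ : _ - _ = orient c d a - orient c d b) //.
  by rewrite /orient; ring.
by apply: point_eq; rewrite /crossing !mxE; rewrite /orient in cd0 ab0 *; field.
Qed.

Lemma orient_crossing a b c d e f : orient c d a != orient c d b ->
  orient e f (crossing a b c d) * (orient c d a - orient c d b) =
  concurrency a b c d e f.
Proof.
rewrite -subr_eq0 /crossing orient_conv /concurrency => cd0; field.
exact: cd0.
Qed.

End Crossing.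

(** * Faces bounded by a cycle of chords *)

(** The chords [(a i, b i)] of the drawing are directed so that the cell lies to
    their left, and are listed in the order in which they bound it.  The corner
    number [i] is where chord [i] meets the next one, so the side between the
    corners [i] and [ordS i] lies on chord [ordS i]. *)
Section ChordCell.
Variables (R : realType) (n m : nat) (p : 'I_n -> 'rV[R]_2).
Variables a b : 'I_m.+3 -> 'I_n.

Local Notation side i := (orient (p (a i)) (p (b i))).
Local Notation corner i :=
  (crossing (p (a i)) (p (b i)) (p (a (ordS i))) (p (b (ordS i)))).

Hypothesis next_separates :
  forall i, 0 < side (ordS i) (p (a i)) /\ side (ordS i) (p (b i)) < 0.
Hypothesis separates_next :
  forall i, side i (p (a (ordS i))) < 0 /\ 0 < side i (p (b (ordS i))).
Hypothesis corner_left :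
  forall i j, j != i -> j != ordS i -> 0 < side j (corner i).
Hypothesis edges_avoid_cell :
  forall c d, exists i, side i (p c) <= 0 /\ side i (p d) <= 0.

Lemma corner_on_chord i : exists r, [/\ 0 < r, r < 1 &
  corner i = (1 - r) *: p (a i) + r *: p (b i)].
Proof. by have [? ?] := next_separates i; exact: crossing_inside. Qed.

Lemma corner_on_next i : exists r, [/\ 0 < r, r < 1 &
  corner i = (1 - r) *: p (a (ordS i)) + r *: p (b (ordS i))].
Proof.
have [sa sb] := next_separates i; have [ta tb] := separates_next i.
rewrite crossingC; last by apply/eqP; lra.
have [r [r0 r1 ->]] := crossing_inside tb ta.
exists (1 - r); split; [lra|lra|].
by rewrite subKr addrC.
Qed.

(** Chord [ordS i] starts on the left of its successor and meets it at corner
    [ordS i].  Corner [i] is also on the left of the successor, so it comes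
    before corner [ordS i] in the direction of chord [ordS i]. *)
Lemma corner_side i : exists2 l, 0 < l &
  forall x, orient (corner i) (corner (ordS i)) x = l * side (ordS i) x.
Proof.
have [s [s0 s1 sE]] := corner_on_next i.
have [t [t0 t1 tE]] := corner_on_chord (ordS i).
exists (t - s); last by move=> x; rewrite sE tE orient_subsegment.
have [ha hb] := next_separates (ordS i).
have := @corner_left i (ordS (ordS i)); rewrite ordSS_neq ordS_neq => /(_ isT isT).
rewrite sE orient_conv => A.
have : side (ordS (ordS i)) (corner (ordS i)) = 0.
  have [r [_ _ ->]] := corner_on_next (ordS i).
  by rewrite orient_conv orient_start orient_end !mulr0 addr0.
by rewrite tE orient_conv; nra.
Qed.

Lemma corners_ccw : ccw_polygon (fun i => corner i).
Proof.
move=> i k ki kSi; have [l l0 ->] := corner_side i; rewrite mulr_gt0 //.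
apply: corner_left; first by rewrite eq_sym.
by rewrite eq_sym (can_eq (@ordSK _)).
Qed.

Lemma chord_cell_kface : exists F, is_kface p m.+3 F.
Proof.
have cell_side x : polygon_cell (fun i => corner i) x -> forall i, 0 < side i x.
  move=> xP i; have := xP (ord_pred i); have [l l0 ->] := corner_side (ord_pred i).
  by rewrite ord_predK pmulr_rgt0.
exists (polygon_cell (fun i => corner i)); apply: polygon_kface.
- exact: corners_ccw.
- move=> i x xi; right; exists (a (ordS i), b (ordS i)) => /=.
    by apply/eqP => ab; have [] := separates_next i; rewrite ab; lra.
  apply: (subsegment _ _ xi).
    have [r [r0 r1 ->]] := corner_on_next i.
    by exists r => //=; rewrite in_itv /= !ltW.
  have [r [r0 r1 ->]] := corner_on_chord (ordS i).
  by exists r => //=; rewrite in_itv /= !ltW.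
apply/seteqP; split=> // x [/cell_side xP]; case=> [[c _ cx]|[[c d] /= _ xcd]].
  by have [i [ic _]] := edges_avoid_cell c c; have := xP i; rewrite -cx ltNge ic.
have [i [ic id]] := edges_avoid_cell c d; have := xP i.
by rewrite ltNge (orient_segment_le0 xcd).
Qed.

End ChordCell.

(** * Cyclic labelling of points in convex position *)

Definition ccw_labelled (R : realType) n (q : 'I_n -> 'rV[R]_2) :=
  forall i j k : 'I_n, (i < j)%N -> (j < k)%N -> 0 < orient (q i) (q j) (q k).

Definition cyclic (i j k : nat) :=
  [|| (i < j < k)%N, (j < k < i)%N | (k < i < j)%N].

Section Labelling.
Variables (R : realType) (n : nat).
Implicit Types p q : 'I_n -> 'rV[R]_2.

Lemma convex_orient_neq0 p i j k : convex_drawing p ->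
  i != j -> i != k -> j != k -> orient (p i) (p j) (p k) != 0.
Proof.
case=> -[p_inj no3 _] ij ik jk; apply/eqP => /orient0_line.
by rewrite (inj_eq p_inj) => /(_ ij); exact: no3.
Qed.

Lemma convex_empty_triangle p i j k l : convex_drawing p ->
  l != i -> l != j -> l != k ->
  0 < orient (p i) (p j) (p l) -> 0 < orient (p j) (p k) (p l) ->
  0 < orient (p k) (p i) (p l) -> False.
Proof.
case=> _ /(_ l) extreme li lj lk ijl jkl kil; apply: extreme.
have im h : l != h -> [set p j | j in [set j | j != l]] (p h).
  by move=> lh; exists h => //=; rewrite eq_sym.
by apply: (@triangle_hull _ _ (p i) (p j) (p k)); rewrite ?(ltW kil) //; exact: im.
Qed.

(** Sort the points by their direction seen from [p o].  This order is transitive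
    because [p o] is not inside a triangle of the others, and it makes every
    increasing triple counterclockwise because the middle point is not inside
    the triangle formed by [p o] and the other two. *)
Lemma convex_ccw_labelling p (o : 'I_n) : convex_drawing p ->
  exists2 s : 'I_n -> 'I_n, bijective s & ccw_labelled (p \o s).
Proof.
move=> p_convex; pose det i j k := orient (p i) (p j) (p k).
have det_neq0 i j k : i != j -> i != k -> j != k -> det i j k != 0.
  exact: convex_orient_neq0.
pose le i j := [|| i == o, i == j | 0 < det o i j].
have le_total : total le.
  move=> i j; rewrite /le; have [//|] := eqVneq i o; rewrite eq_sym => oi.
  have [|ij] := eqVneq i j; first by rewrite orbT.
  have [|] := eqVneq j o; first by rewrite /= !orbT.
  rewrite eq_sym => oj; have := det_neq0 o i j oi oj ij.
  rewrite neq_lt => /orP[oij|->]; last by rewrite orbT.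
  by apply/orP; right; rewrite /det orient_swapr oppr_gt0 -/(det o i j) oij !orbT.
have det_oo i : det o i o = 0 by exact: orient_start.
have le_trans : transitive le.
  move=> y x z; rewrite /le; have [//|xo] := eqVneq x o.
  have [<- _|xy /= oxy] := eqVneq x y; first by rewrite (negPf xo).
  have yo : y != o by apply: contraTneq oxy => ->; rewrite det_oo ltxx.
  rewrite (negPf yo) /=.
  have [<- _|yz /= oyz] := eqVneq y z; first by rewrite oxy orbT.
  have zo : z != o by apply: contraTneq oyz => ->; rewrite det_oo ltxx.
  have [//|xz /=] := eqVneq x z; apply: contraT; rewrite -leNgt => oxz.
  exfalso; apply: (@convex_empty_triangle p x y z o); rewrite 1?eq_sym //.
  - by rewrite -orient_rot.
  - by rewrite -orient_rot.
  - rewrite -orient_rot orient_swapr oppr_gt0 lt_neqAle oxz andbT.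
    by rewrite det_neq0 // eq_sym.
pose s := sort le (enum 'I_n).
have s_size : size s = n by rewrite size_sort size_enum_ord.
have s_uniq : uniq s by rewrite sort_uniq enum_uniq.
pose f (i : 'I_n) := nth o s i.
have f_neq (i j : 'I_n) : i != j -> f i != f j.
  by move=> ij; rewrite nth_uniq ?s_size.
exists f; first by apply: injF_bij => i j /eqP; apply: contraTeq => /f_neq.
have f_le (i j : 'I_n) : (i < j)%N -> le (f i) (f j).
  move=> ij; apply: (sorted_ltn_nth le_trans) => //; rewrite ?inE ?s_size //.
  exact: sort_sorted.
move=> i j k ij jk /=.
have fij : f i != f j by rewrite f_neq // -val_eqE neq_ltn ij.
have fjk : f j != f k by rewrite f_neq // -val_eqE neq_ltn jk.
have fik : f i != f k by rewrite f_neq // -val_eqE neq_ltn (ltn_trans ij jk).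
have := f_le _ _ ij; have := f_le _ _ jk.
move: (f i) (f j) (f k) fij fjk fik => x y z xy yz xz.
rewrite /le (negPf xy) (negPf yz) /=; have [xo|xo /=] := eqVneq x o.
  by move: xy; rewrite xo eq_sym => /negPf->.
move=> oyz oxy.
have yo : y != o by apply: contraTneq oxy => ->; rewrite det_oo ltxx.
move: oyz; rewrite (negPf yo) /= => oyz.
apply: contraT; rewrite -leNgt le_eqVlt (negPf (det_neq0 _ _ _ xy xz yz)) /= => xyz0.
exfalso; apply: (@convex_empty_triangle p o x z y) => //; rewrite 1?eq_sym //.
- by rewrite orient_swapr oppr_gt0.
- by rewrite orient_rot.
Qed.

Lemma drawing_set_relabel p (s : 'I_n -> 'I_n) :
  bijective s -> drawing_set (p \o s) = drawing_set p.
Proof.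
move=> [t st ts]; apply/seteqP; split=> x; case=> [[i _ ix]|[[i j] /= ij xij]].
- by left; exists (s i).
- by right; exists (s i, s j) => //=; rewrite (can_eq st).
- by left; exists (t i) => //=; rewrite ts.
- by right; exists (t i, t j) => /=; rewrite ?(can_eq ts) ?ts.
Qed.

Lemma is_kface_relabel p (s : 'I_n -> 'I_n) k F :
  bijective s -> is_kface (p \o s) k F -> is_kface p k F.
Proof. by move=> sb; rewrite /is_kface /is_face drawing_set_relabel. Qed.

Lemma orient_cyclic q (i j k : 'I_n) :
  ccw_labelled q -> cyclic i j k -> 0 < orient (q i) (q j) (q k).
Proof.
move=> qc /or3P[] /andP[ij jk]; first exact: qc.
  by rewrite orient_rot; exact: qc.
by rewrite -orient_rot; exact: qc.
Qed.

Lemma ccw_labelled_shift q : ccw_labelled q -> ccw_labelled (q \o @ordS n).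
Proof.
move=> qc i j k ij jk /=; apply: orient_cyclic => //; rewrite /cyclic /=.
have kn := ltn_ord k.
have S0 (l : nat) : (l < k -> l.+1 %% n = l.+1)%N.
  by move=> lk; rewrite modn_small //; lia.
rewrite (S0 i) ?(S0 j) //; last exact: ltn_trans jk.
have [kS|kS] := eqVneq k.+1 n; first by rewrite kS modnn; lia.
by rewrite modn_small; lia.
Qed.

End Labelling.

(** * The heptagon *)

Section Heptagon.
Variable R : realType.
Implicit Type q : 'I_7 -> 'rV[R]_2.

Local Notation at_ q i := (q (inZp i)).

(** Positive exactly when the crossing point of the diagonals [15] and [26] is on
    the inner side of the boundary [04] of the wedge [3 0 4] at vertex [0]. *)
Definition inside04 q := concurrency
  (at_ q 4) (at_ q 0) (at_ q 1) (at_ q 5) (at_ q 2) (at_ q 6).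

(** The same for the boundary [03] of that wedge. *)
Definition inside03 q := concurrency
  (at_ q 0) (at_ q 3) (at_ q 1) (at_ q 5) (at_ q 2) (at_ q 6).

(** The diagonals [40], [15], [26] of the shifted labelling are the diagonals
    [51], [26], [30] of the original one. *)
Lemma inside04_shift q : inside04 (q \o @ordS 7) = inside03 q.
Proof.
have S i : ordS (inZp i : 'I_7) = inZp i.+1.
  by apply: val_inj; rewrite /= -[X in (X %% _)%N]addn1 modnDml addn1.
rewrite /inside04 /inside03 /= !S (_ : inZp 7 = inZp 0); last exact: val_inj.
by rewrite concurrency_swap 2!concurrency_rot concurrency_swap opprK.
Qed.

(** If the crossing point [z] were outside both boundaries, then [0] would be a
    convex combination of [z], [3] and [4]; but all three are strictly on the
    same side of the edge [01]. *)
Lemma inside_one_boundary q : ccw_labelled q -> 0 < inside04 q \/ 0 < inside03 q.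
Proof.
move=> qc; apply/orP; apply: contraT; rewrite negb_or -!leNgt => /andP[].
have pos i j k : cyclic (inZp i : 'I_7) (inZp j : 'I_7) (inZp k : 'I_7) ->
  0 < orient (at_ q i) (at_ q j) (at_ q k) by exact: orient_cyclic.
have h261 := pos 2%N 6%N 1%N isT; have h256 := pos 2%N 5%N 6%N isT.
have h034 := pos 0%N 3%N 4%N isT; have h013 := pos 0%N 1%N 3%N isT.
have h014 := pos 0%N 1%N 4%N isT; have h015 := pos 0%N 1%N 5%N isT.
rewrite /inside04 /inside03 !(concurrency_rot (at_ q _) (at_ q _) (at_ q 1)).
move: h261 h256 h034 h013 h014 h015.
set q0 := at_ q 0; set q1 := at_ q 1; set q2 := at_ q 2; set q3 := at_ q 3.
set q4 := at_ q 4; set q5 := at_ q 5; set q6 := at_ q 6.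
move=> h261 h256 h034 h013 h014 h015.
have h265 : orient q2 q6 q5 < 0 by rewrite orient_swapr oppr_lt0.
have W : 0 < orient q2 q6 q1 - orient q2 q6 q5 by lra.
rewrite -!orient_crossing; try by apply/eqP; lra.
set z := crossing _ _ _ _; rewrite !pmulr_lle0 // => z40 z03.
have z01 : 0 < orient q0 q1 z.
  have [r [r0 r1 zE]] := crossing_inside h261 h265.
  by rewrite /z zE orient_conv orient_end mulr0 add0r mulr_gt0.
have : orient q0 q1 z * orient q0 q3 q4 =
    orient q0 q1 q3 * orient q4 q0 z + orient q0 q1 q4 * orient q0 q3 z.
  by rewrite /orient; ring.
nra.
Qed.

(** The sides of the pentagon lie, in counterclockwise order, on the chords [61],
    [03], [15], [26] and [40]. *)
Lemma apex_pentagon q : ccw_labelled q -> 0 < inside04 q -> 0 < inside03 q ->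
  exists F, is_kface q 5 F.
Proof.
move=> qc in04 in03.
pose a (i : 'I_5) : 'I_7 := inZp (nth 0%N [:: 6; 0; 1; 2; 4] i).
pose b (i : 'I_5) : 'I_7 := inZp (nth 0%N [:: 1; 3; 5; 6; 0] i).
pose side i := orient (q (a i)) (q (b i)).
pose corner i := crossing (q (a i)) (q (b i)) (q (a (ordS i))) (q (b (ordS i))).
pose strictly_left i (c : 'I_7) := cyclic (a i) (b i) c.
pose strictly_right i (c : 'I_7) := cyclic (a i) c (b i).
pose on_left i c := [|| c == a i, c == b i | strictly_left i c].
pose on_right i c := [|| c == a i, c == b i | strictly_right i c].
have side_gt0 i c : strictly_left i c -> 0 < side i (q c) by exact: orient_cyclic.
have side_lt0 i c : strictly_right i c -> side i (q c) < 0.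
  by move=> h; rewrite /side orient_swapr oppr_lt0 orient_cyclic.
have side_ge0 i c : on_left i c -> 0 <= side i (q c).
  by case/or3P=> [/eqP->|/eqP->|/side_gt0/ltW//];
    rewrite /side ?orient_start ?orient_end.
have side_le0 i c : on_right i c -> side i (q c) <= 0.
  by case/or3P=> [/eqP->|/eqP->|/side_lt0/ltW//];
    rewrite /side ?orient_start ?orient_end.
have next_separates i : 0 < side (ordS i) (q (a i)) /\ side (ordS i) (q (b i)) < 0.
  by split; [apply: side_gt0|apply: side_lt0]; case: i => -[|[|[|[|[|//]]]]] ?.
have separates_next i : side i (q (a (ordS i))) < 0 /\ 0 < side i (q (b (ordS i))).
  by split; [apply: side_lt0|apply: side_gt0]; case: i => -[|[|[|[|[|//]]]]] ?.
apply: (@chord_cell_kface R 7 2 q a b) => //; last first.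
  move=> c d; suff [i /andP[ic id]] : exists i, on_right i c && on_right i d.
    by exists i; split; exact: side_le0.
  case: c d => -[|[|[|[|[|[|[|//]]]]]]] ? [] [|[|[|[|[|[|[|//]]]]]]] ?;
    by [exists (inZp 0)|exists (inZp 1)|exists (inZp 2)|exists (inZp 3)|exists (inZp 4)].
move=> i j; have [ha hb] := next_separates i.
(* A corner is strictly inside both of its chords, so it is to the left of every
   chord that has the ends of one of them on its left.  This settles all but four
   cases: the corners z = 15.26, 03.15 and 26.40 against the third line of the
   triples 03, 15, 26 and 40, 15, 26. *)
have left_conv c d r : 0 < r -> r < 1 ->
    on_left j c && on_left j d && (strictly_left j c || strictly_left j d) ->
    0 < side j ((1 - r) *: q c + r *: q d).
  move=> r0 r1 /andP[/andP[/side_ge0 lc /side_ge0 ld] cd]; rewrite /side orient_conv.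
  have r1' : 0 < 1 - r by rewrite subr_gt0.
  by case/orP: cd => /side_gt0 sp; [apply: ltr_wpDr|apply: ltr_wpDl];
    rewrite ?(mulr_gt0, mulr_ge0) ?(ltW r0) ?(ltW r1').
have by_chord : on_left j (a i) && on_left j (b i) &&
    (strictly_left j (a i) || strictly_left j (b i)) -> 0 < side j (corner i).
  have [r [r0 r1 rE]] := corner_on_chord next_separates i.
  by rewrite /corner rE; exact: left_conv.
have by_next : on_left j (a (ordS i)) && on_left j (b (ordS i)) &&
    (strictly_left j (a (ordS i)) || strictly_left j (b (ordS i))) ->
    0 < side j (corner i).
  have [r [r0 r1 rE]] := corner_on_next next_separates separates_next i.
  by rewrite /corner rE; exact: left_conv.
have by_concurrency :
    0 < concurrency (q (a i)) (q (b i)) (q (a (ordS i))) (q (b (ordS i)))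
                    (q (a j)) (q (b j)) -> 0 < side j (corner i).
  rewrite /side in ha hb; rewrite -orient_crossing; last by apply/eqP; lra.
  by rewrite pmulr_lgt0 //; lra.
move: by_chord by_next by_concurrency; rewrite -/(side j) -/(corner i).
case: i {ha hb} => -[|[|[|[|[|//]]]]] ?;
  case: j {left_conv} => -[|[|[|[|[|//]]]]] ? H1 H2 H3 // _ _;
  try (by apply: H1); try (by apply: H2); apply: H3.
- exact: in03.
- by rewrite -concurrency_rot; exact: in03.
- by rewrite -concurrency_rot; exact: in04.
- by rewrite concurrency_rot; exact: in04.
Qed.

End Heptagon.

Lemma ordS_bij n : bijective (@ordS n).
Proof. exists (@ord_pred n); [exact: ordSK|exact: ord_predK]. Qed.

Theorem proposition5 (R : realType) (p : 'I_7 -> 'rV[R]_2) :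
  convex_drawing p -> exists F : set 'rV[R]_2, is_kface p 5 F.
Proof.
move=> p_convex; have [s s_bij s_ccw] := convex_ccw_labelling ord0 p_convex.
apply: contrapT => no_face.
pose q r : 'I_7 -> 'rV[R]_2 := iter r (fun f => f \o @ordS 7) (p \o s).
have q_ccw r : ccw_labelled (q r).
  by elim: r => //= r IHr; exact: ccw_labelled_shift.
have q_no_face r : ~ exists F, is_kface (q r) 5 F.
  elim: r => [|r IHr] [F] /is_kface_relabel qF.
    by apply: no_face; exists F; exact: qF.
  by apply: IHr; exists F; apply: qF; exact: ordS_bij.
have alternate r : (0 < inside03 (q r.+1)) = ~~ (0 < inside03 (q r)).
  have := inside_one_boundary (q_ccw r.+1); have := apex_pentagon (q_ccw r.+1).
  rewrite inside04_shift => pentagon.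
  case: (0 < inside03 (q r)) (0 < inside03 (q r.+1)) pentagon => [] [] // pentagon.
    by case: (q_no_face r.+1); exact: pentagon.
  by case.
have q7 : q 7 = q 0.
  apply/funext => i; congr (p (s _)); apply: val_inj.
  by case: i => -[|[|[|[|[|[|[|]]]]]]].
(* Seven alternations turn the sign at q 0 into its negation at q 7 = q 0. *)
by have := alternate 6; rewrite q7 !alternate; case: (0 < _).
Qed.
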